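(* Let $\rho$ be a coherent distortion risk measure on $L^1$, with (concave) distortion function $h\in\mathcal D$. The following are equivalent. (i) $\rho$ is expectation-dominated. (ii) $\rho$ is finite on $L^1$. (iii) The distortion function $h$ of $\rho$ satisfies $\lim_{t\downarrow0}h(t)/t<\infty$.
   Context: Fix an atomless probability space $(\Omega,\mathcal F,\mathbb P)$; random variables are real-valued and almost surely equal ones are identified; $L^1$ is the set of integrable random variables and $L^1_+$ the set of nonnegative ones in $L^1$. $\mathcal D$ is the set of (non-strictly) increasing functions $h:[0,1]\to[0,1]$ with $h(0)=0$, $h(1)=1$. A coherent distortion risk measure on $L^1$ is a functional of the form $\rho=\rho_h:L^1\to(-\infty,\infty]$, $$\rho_h(X)=\int_0^\infty h(\mathbb P(X>x))\,dx+\int_{-\infty}^0\big(h(\mathbb P(X>x))-1\big)\,dx ,$$ with $h\in\mathcal D$ concave ($h$ may be discontinuous at $0$); $h$ is called its distortion function. $\rho$ is expectation-dominated if there exists $c>0$ such that $\rho(X)\le c\,\mathbb E[X]$ for all $X\in L^1_+$. $\rho$ is finite on $L^1$ if $\rho(X)<\infty$ for all $X\in L^1$. *)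

(* Defs.v *)
From HB Require Import structures.
From mathcomp Require Import all_boot all_order all_algebra.
From mathcomp Require Import all_classical all_reals all_analysis.

Set Implicit Arguments.
Unset Strict Implicit.
Unset Printing Implicit Defensive.

Import Order.TTheory GRing.Theory Num.Theory.
Import numFieldNormedType.Exports.

Local Open Scope classical_set_scope.
Local Open Scope ring_scope.

Section atomless.
Context d (T : measurableType d) (R : realType).
Local Open Scope ereal_scope.

Definition atomless (P : probability T R) : Prop :=
  forall A : set T, measurable A -> 0 < P A ->
    exists B : set T, [/\ measurable B, B `<=` A & 0 < P B < P A].

End atomless.

Section distortion_functions.
Context (R : realType).

(* A function [0,1] -> [0,1] is represented by a total function on R of which
   only the values on [0,1] are ever constrained or used. *)
Definition distortion_function (h : R -> R) : Prop :=
  [/\ {in `[0, 1] &, {homo h : s t / s <= t}},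
      (forall t, t \in `[0, 1] -> h t \in `[0, 1]),
      h 0 = 0
    & h 1 = 1].

Definition concave_function (D : set R) (h : R -> R) : Prop :=
  convex_function (E := R^o) D (fun t => - h t).

End distortion_functions.

Section risk_measures.
Context d (T : measurableType d) (R : realType) (P : probability T R).
Local Open Scope ereal_scope.

(* A sum of the form +oo - oo does not occur for X in L^1 and h concave, because
   then h t >= t on [0,1], so that the second integral is finite. *)
Definition distortion_integral (h : R -> R) (X : {RV P >-> R}) : \bar R :=
  \int[lebesgue_measure]_(x in `[0%R, +oo[) (h (fine (ccdf X x)))%:E
  + \int[lebesgue_measure]_(x in `]-oo, 0%R]) (h (fine (ccdf X x)) - 1)%:E.

(* Functionals on L^1 are represented by functions of random variables that are
   only ever evaluated at integrable ones; distortion_integral depends on X only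
   through its law, hence only on its almost sure class. *)
Definition coherent_distortion_risk_measure
    (h : R -> R) (rho : {RV P >-> R} -> \bar R) : Prop :=
  [/\ distortion_function h,
      concave_function `[0%R, 1%R] h
    & forall X : {RV P >-> R}, (X : T -> R) \in Lfun P 1 ->
        rho X = distortion_integral h X].

Definition expectation_dominated (rho : {RV P >-> R} -> \bar R) : Prop :=
  exists2 c : R, (0 < c)%R &
    forall X : {RV P >-> R}, (X : T -> R) \in Lfun P 1 ->
      {ae P, forall w, (0 <= X w)%R} -> rho X <= c%:E * 'E_P[X].

Definition finite_on_L1 (rho : {RV P >-> R} -> \bar R) : Prop :=
  forall X : {RV P >-> R}, (X : T -> R) \in Lfun P 1 -> rho X < +oo.

End risk_measures.

(* Main.v *)
(** The concavity of [h] and [h 0 = 0] make [h t / t] nonincreasing, so it tends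
    at [0] to its supremum [l] over [0 < t <= 1].  If [l] is finite, then
    [h t <= l * t], and integrating this against the tail of [X] bounds [rho X]
    by [l] times the integral of [P (X > x)] over [x >= 0].  If [l] is infinite,
    pick events [A n] of positive but so small probability [p n] that
    [h (p n) / p n >= n * 2 ^ n.+1]; the sum [X] of the indicators of the [A n]
    weighted by [1 / (2 ^ n.+1 * p n)] is nonnegative with expectation [1],
    whereas [rho X >= h (p n) / (2 ^ n.+1 * p n) >= n] for all [n], which is
    incompatible with both domination by the expectation and finiteness. *)
Require Import Defs.
From mathcomp Require Import all_boot all_order all_algebra.
From mathcomp Require Import all_classical all_reals all_analysis.
From mathcomp Require Import measurable_realfun.
Set Implicit Arguments.
Unset Strict Implicit.
Unset Printing Implicit Defensive.
Import Order.TTheory GRing.Theory Num.Theory.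
Import numFieldNormedType.Exports.
Local Open Scope classical_set_scope.
Local Open Scope ring_scope.

(** For [0 < s <= t], the point [s] is the convex combination of [t] and [0] with weight [s / t] on
    [t]; concavity and [h 0 = 0] give [s / t * h t <= h s]. *)
Lemma concave_ratio_nonincreasing (R : realType) (h : R -> R) :
  concave_function `[0, 1] h -> h 0 = 0 ->
  {in `]0, 1] &, {homo (fun t => h t / t) : s t /~ s <= t}}.
Proof.
move=> hc h0 t s; rewrite !in_itv/= => /andP[t0 t1] /andP[s0 s1] st.
have u0 : 0 <= s / t by rewrite divr_ge0 ?ltW.
have u1 : s / t <= 1 by rewrite ler_pdivrMr ?mul1r.
have := hc (Itv01 u0 u1) t 0.
rewrite !inE/= !in_itv/= (ltW t0) t1 lexx ler01 => /(_ isT isT).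
change (- h (conv (Itv01 u0 u1) (t : R^o) (0 : R^o)) <=
  conv (Itv01 u0 u1) (- h t : R^o) (- h 0 : R^o) -> h t / t <= h s / s).
rewrite !convRE h0 oppr0 !mulr0 !addr0 mulrN lerN2.
change (s / t * h t <= h (s / t * t) -> h t / t <= h s / s).
rewrite divfK ?gt_eqF//.
by move=> H; rewrite ler_pdivlMr// mulrC mulrA mulrAC.
Qed.

(** * Events of small positive probability *)

Section atomless.
Context d (T : measurableType d) (R : realType) (P : probability T R).
Local Open Scope ereal_scope.
Hypothesis hP : atomless P.

(** Atomlessness splits [A] into two pieces of positive probability; the lighter one carries at most
    half of [P A]. *)
Lemma atomless_half (A : set T) : measurable A -> 0 < P A ->
  exists B, [/\ measurable B, 0 < P B & 2%:E * P B <= P A].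
Proof.
move=> mA A0; have [B [mB BA /andP[B0 BltA]]] := hP mA A0.
have mAB : measurable (A `\` B) by exact: measurableD.
have AE : P A = P B + P (A `\` B).
  by rewrite -measureU// ?setDUK// setDIK.
have [le|/ltW le] := leP (P B) (P (A `\` B)).
  by exists B; split => //; rewrite AE mule_natl mule2n leeD.
exists (A `\` B); split => //; last by rewrite AE mule_natl mule2n leeD.
rewrite lt0e measure_ge0 andbT; apply/eqP => AB0.
by move: BltA; rewrite AE AB0 adde0 ltxx.
Qed.

Lemma atomless_small (e : R) : (0 < e)%R ->
  exists A, [/\ measurable A, 0 < P A & P A < e%:E].
Proof.
move=> e0.
(* Halve the whole space [n] times. *)
have small n : exists A, [/\ measurable A, 0 < P A & (2 ^ n)%:R%:E * P A <= 1].
  elim: n => [|n [A [mA A0 An]]].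
    by exists setT; split; rewrite // probability_setT ?lte01// mul1e.
  have [B [mB B0 BA]] := atomless_half mA A0.
  exists B; split => //; apply: le_trans An.
  rewrite expnSr natrM EFinM -muleA lee_wpmul2l//.
have [n en] : exists n, (e^-1 < (2 ^ n)%:R)%R.
  exists (Num.truncn e^-1).+1; rewrite (lt_le_trans (truncnS_gt _))//.
  by rewrite ler_nat ltnW// ltn_expl.
have [A [mA A0 An]] := small n; exists A; split=> //.
rewrite -(fineK (fin_num_measure P A mA)) in An A0 *.
move: An A0; rewrite -EFinM !lee_fin !lte_fin => An A0.
rewrite -[e]invrK -div1r ltr_pdivlMr ?invr_gt0//.
by apply: lt_le_trans An; rewrite mulrC ltr_pM2r.
Qed.

End atomless.

(** * Bounds on the distortion integral *)

Section distortion.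
Context d (T : measurableType d) (R : realType) (P : probability T R).
Local Open Scope ereal_scope.
Variable h : R -> R.
Hypothesis hh : distortion_function h.

Let fine_ccdf01 (X : {RV P >-> R}) x : fine (ccdf X x) \in `[0%R, 1%R].
Proof.
rewrite in_itv/= fine_ge0//= -lee_fin fineK ?fin_num_measure//.
exact: probability_le1.
Qed.

Let hccdf_ge0 (X : {RV P >-> R}) x : (0 <= h (fine (ccdf X x)))%R.
Proof.
have [_ hr _ _] := hh.
by have := hr _ (fine_ccdf01 X x); rewrite in_itv => /andP[].
Qed.

(** Since [h] may jump, measurability comes from monotonicity: an increasing function of the
    nonincreasing tail is nonincreasing. *)
Lemma measurable_distortion_ccdf (X : {RV P >-> R}) (D : set R) :
  measurable D ->
  measurable_fun D (fun x => h (fine (ccdf X x))).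
Proof.
case: hh => hm _ _ _ mD.
apply: nonincreasing_measurable => // x y xy; apply: hm => //.
by rewrite fine_le ?fin_num_measure// ccdf_nonincreasing.
Qed.

(** The integral over the negative half-line is at most [0] because [h <= 1]; on the other half-line
    the linear bound applies pointwise. *)
Lemma distortion_integral_le (L : R) (X : {RV P >-> R}) :
  (0 <= L)%R -> (forall t, t \in `[0%R, 1%R] -> h t <= L * t)%R ->
  distortion_integral h X
    <= L%:E * \int[lebesgue_measure]_(x in `[0%R, +oo[) ccdf X x.
Proof.
move=> L0 hL; have [_ hr _ _] := hh.
have h1_ge0 x : 0 <= (1 - h (fine (ccdf X x)))%:E.
  rewrite lee_fin subr_ge0.
  by have := hr _ (fine_ccdf01 X x); rewrite in_itv => /andP[].
rewrite /distortion_integral -[leRHS]adde0 leeD//; last first.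
  under eq_integral do rewrite -opprB EFinN.
  by rewrite integral_ge0N// oppe_le0 integral_ge0.
rewrite -ge0_integralZl//; last first.
  by apply: measurable_funTS; exact: ccdf_measurable.
apply: ge0_le_integral => //.
- by move=> x _; rewrite lee_fin.
- apply/measurable_EFinP; exact: measurable_distortion_ccdf.
- apply: measurable_funeM; apply: measurable_funTS; exact: ccdf_measurable.
- move=> x _; rewrite -[ccdf X x]fineK ?fin_num_measure// -EFinM lee_fin.
  by apply: hL; exact: fine_ccdf01.
Qed.

(** For [0 <= x < a] the event [X > x] contains [X >= a], so the graph of the integrand lies above a
    rectangle of width [a] and height [h t]. *)
Lemma distortion_integral_ge (X : {RV P >-> R}) (a t : R) :
  (forall w, 0 <= X w)%R -> (0 <= a)%R -> t \in `[0%R, 1%R] ->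
  t%:E <= P (X @^-1` `[a, +oo[) ->
  (a * h t)%:E <= distortion_integral h X.
Proof.
move=> X0 a0 t01 ta; have [hm hr h00 h1] := hh.
rewrite /distortion_integral.
rewrite [X in _ + X](_ : _ = 0) ?adde0; last first.
  (* The endpoint [0] is removed because [P (X > 0)] may be less than [1]; for [x < 0] the tail is
     exactly [1]. *)
  rewrite -integral_itv_bndo_bndc//; last first.
    apply/measurable_EFinP/measurable_funB => //.
    exact: measurable_distortion_ccdf.
  apply: integral0_eq => x /=; rewrite in_itv/= => x0.
  rewrite (_ : ccdf X x = 1) ?h1 ?subrr//.
  rewrite -(probability_setT P); congr (P _); apply/seteqP; split => // w _ /=.
  by rewrite in_itv/= andbT (lt_le_trans x0).
apply: (@le_trans _ _ (\int[lebesgue_measure]_(x in `[0%R, a[) (h t)%:E)).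
  rewrite integral_cst//= lebesgue_measure_itv/= lte_fin mulrC EFinM.
  case: ltP => [_|a0']; first by rewrite oppr0 adde0.
  by rewrite (@le_anti _ _ a 0%R) ?a0 ?a0'// !mule0.
apply: (@le_trans _ _
    (\int[lebesgue_measure]_(x in `[0%R, a[) (h (fine (ccdf X x)))%:E)).
  apply: ge0_le_integral => //.
  - move=> x _; rewrite lee_fin.
    by have := hr _ t01; rewrite in_itv/= => /andP[].
  - apply/measurable_EFinP; exact: measurable_distortion_ccdf.
  - move=> x /=; rewrite in_itv/= => /andP[x0 xa].
    rewrite lee_fin; apply: hm => //.
    rewrite -lee_fin fineK ?fin_num_measure//; apply: (le_trans ta).
    apply: le_measure; rewrite ?inE; [exact: measurable_funPTI..|].
    by move=> w/=; rewrite !in_itv/= !andbT; apply: lt_le_trans.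
apply: ge0_subset_integral => //.
- apply/measurable_EFinP; exact: measurable_distortion_ccdf.
- by move=> x _; rewrite lee_fin.
- by apply: subset_itvl.
Qed.

End distortion.

(** * An integrable variable with infinite risk *)

Lemma exists_integrable_ge d (T : measurableType d) (R : realType)
    (P : probability T R) (A : (set T)^nat) :
  (forall n, measurable (A n)) -> (forall n, 0 < P (A n))%E ->
  exists X : {RV P >-> R}, [/\ (X : T -> R) \in Lfun P 1,
    (forall w, 0 <= X w) &
    forall n, (P (A n) <=
      P (X @^-1` `[(((2 ^ n.+1)%:R * fine (P (A n)))^-1)%R, +oo[))%E].
Proof.
move=> mA A0.
have fA0 n : 0 < fine (P (A n)).
  by rewrite fine_gt0// A0 ltey_eq fin_num_measure.
(* This weight gives the [n]-th term of the series expectation [1 / 2 ^ n.+1]. *)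
pose a n : R := ((2 ^ n.+1)%:R * fine (P (A n)))^-1.
have a0 n : 0 <= a n by rewrite invr_ge0 mulr_ge0// ltW.
pose f n (w : T) : \bar R := (a n * \1_(A n) w)%:E.
have f0 n w : (0 <= f n w)%E by rewrite lee_fin mulr_ge0.
have mf n : measurable_fun setT (f n).
  apply/measurable_EFinP.
  by apply: measurable_funM => //; exact: measurable_indic.
pose S w := (\sum_(0 <= n <oo) f n w)%E.
have S0 w : (0 <= S w)%E by exact: nneseries_ge0.
have mS : measurable_fun setT S by exact: ge0_emeasurable_sum.
have intS : (\int[P]_w S w < +oo)%E.
  rewrite integral_nneseries//.
  rewrite (eq_eseriesr (g := fun n => (1 / (2 ^ (n + 1))%:R)%:E)); last first.
    move=> n _; rewrite /f.
    under eq_integral do rewrite EFinM.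
    rewrite ge0_integralZl ?lee_fin//; last first.
      by apply/measurable_EFinP; exact: measurable_indic.
    rewrite integral_indic// setIT.
    have -> : ((a n)%:E * P (A n) = (a n * fine (P (A n)))%:E)%E.
      by rewrite EFinM fineK// fin_num_measure.
    by rewrite /a invfM mulfVK ?gt_eqF// addn1 div1r.
  by rewrite (cvg_lim _ (@cvg_geometric_eseries_half _ 1 0))// ltry.
have iS : P.-integrable setT S.
  by apply/integrableP; split => //; under eq_integral do rewrite gee0_abs//.
(* [fine] sends the value [+oo] of [S] to [0], which could break the lower bound on [A n];
   integrability of [S] confines this to a null set [N], so [A n] is covered by [X0 >= a n] and
   [N]. *)
pose X0 := fine \o S.
have mX0 : measurable_fun setT X0.
  apply: (measurable_comp measurableT) => //; exact: fine_measurable.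
exists (mfun_Sub (mem_set mX0)); split => /=.
- apply/Lfun1_integrable; apply/integrableP; split.
    exact/measurable_EFinP.
  apply: le_lt_trans intS; apply: ge0_le_integral => //.
  + by apply: measurableT_comp => //; apply/measurable_EFinP.
  + move=> w _ /=; rewrite /X0/= ger0_norm ?fine_ge0//.
    by case: (S w) (S0 w) => //= r; rewrite leey.
- by move=> w; rewrite /X0/= fine_ge0.
- move=> n.
  have [N [mN PN0 sN]] := integrable_ae measurableT iS.
  have mB : measurable (X0 @^-1` `[a n, +oo[).
    by rewrite -[X in measurable X]setTI; exact: mX0.
  rewrite -[leRHS]adde0 -PN0; apply: le_trans (measureU2 P mB mN).
  apply: le_measure; rewrite ?inE//; first exact: measurableU.
  move=> w Aw; have [fin|nfin] := pselect (S w \is a fin_num); [left|right].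
    rewrite /= in_itv/= andbT -lee_fin /X0/= fineK//.
    rewrite /S (@nneseriesD1 _ _ n)// {1}/f indicE mem_set// mulr1.
    by rewrite leeDl// nneseries_ge0.
  by apply: sN => /= /(_ I)/nfin.
Qed.


Lemma exists_distortion_integral_pinfty d (T : measurableType d)
    (R : realType) (P : probability T R) (h : R -> R) :
  atomless P -> distortion_function h -> concave_function `[0, 1] h ->
  (forall M, exists2 s, s \in `]0, 1] & M <= h s / s) ->
  exists X : {RV P >-> R}, [/\ (X : T -> R) \in Lfun P 1,
    (forall w, 0 <= X w) & distortion_integral h X = +oo%E].
Proof.
move=> hP hh hc slope; have [_ _ h0 _] := hh.
have fine_gt0 A : measurable A -> (0 < P A)%E -> 0 < fine (P A).
  by move=> mA A0; rewrite fine_gt0// A0 ltey_eq fin_num_measure.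
(* Choose [s] with slope at least [n * 2 ^ n.+1], then an event less probable than [s]: its slope is
   no smaller. *)
have big n : exists A, [/\ measurable A, (0 < P A)%E &
    (n * 2 ^ n.+1)%:R * fine (P A) <= h (fine (P A))].
  have [s] := slope (n * 2 ^ n.+1)%:R; rewrite in_itv/= => /andP[s0 s1] sn.
  have [A [mA A0 As]] := atomless_small hP s0.
  exists A; split => //; rewrite -ler_pdivlMr ?fine_gt0//; apply: (le_trans sn).
  have As' : fine (P A) <= s by rewrite ltW// -lte_fin fineK// fin_num_measure.
  apply: (concave_ratio_nonincreasing hc h0) => //; rewrite in_itv/=.
    by rewrite s0.
  by rewrite fine_gt0//= (le_trans As').
have [A /all_and3[mA A0 An]] := choice big.
have [X [XL X0 XA]] := exists_integrable_ge mA A0.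
exists X; split => //; apply/eqyP => r r0.
(* This [n] exceeds [r], and the factor [2 ^ n.+1] in [An] cancels the one in the weight. *)
pose n := (Num.truncn r).+1; have {}An := An n.
have fA0 : 0 < fine (P (A n)) by rewrite fine_gt0.
have p0 : 0 < (2 ^ n.+1)%:R * fine (P (A n)).
  by rewrite mulr_gt0// ltr0n expn_gt0.
apply: (@le_trans _ _
    (((2 ^ n.+1)%:R * fine (P (A n)))^-1 * h (fine (P (A n))))%:E).
  rewrite lee_fin mulrC ler_pdivlMr//; apply: le_trans An.
  by rewrite natrM -mulrA ler_wpM2r ?ltW// truncnS_gt.
apply: distortion_integral_ge => //.
- by rewrite invr_ge0 ltW.
- rewrite in_itv/= ltW//= -lee_fin fineK ?fin_num_measure//.
  exact: probability_le1.
- by rewrite fineK ?fin_num_measure.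
Qed.

Theorem theorem4p4 (R : realType) (d : measure_display) (T : measurableType d)
    (P : probability T R) (hP : atomless P)
    (h : R -> R) (rho : {RV P >-> R} -> \bar R)
    (hrho : coherent_distortion_risk_measure h rho) :
  (expectation_dominated rho <-> finite_on_L1 rho)
  /\ (finite_on_L1 rho <->
      (exists2 l : \bar R, (h t / t)%:E @[t --> 0^'+] --> l & (l < +oo)%E)).
Proof.
have [hh hc hrhoE] := hrho; have [_ _ h0 h1] := hh.
pose l : \bar R := ereal_sup [set (h t / t)%:E | t in `]0, 1]].
have hl : (h t / t)%:E @[t --> 0^'+] --> l.
  apply: (@nonincreasing_at_right_cvge _ (fun t => (h t / t)%:E) 0 (BRight 1)).
    by rewrite bnd_simp.
  move=> s t sI tI st; rewrite lee_fin.
    exact: (concave_ratio_nonincreasing hc h0).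
have lub t : t \in `]0, 1] -> ((h t / t)%:E <= l)%E.
  by move=> t01; apply: ereal_sup_ubound; exists t.
pose finite_slope :=
  exists2 l : \bar R, (h t / t)%:E @[t --> 0^'+] --> l & (l < +oo)%E.
have linear_bound : finite_slope ->
    exists2 c : R, 0 < c & forall t, t \in `[0, 1] -> h t <= c * t.
  move=> [l' hl' l'oo]; have {l' hl' l'oo} loo : (l < +oo)%E.
    by rewrite (cvg_unique _ hl hl').
  (* The slope at [t = 1] is [1]; this makes the constant [fine l] positive. *)
  have l1 : (1 <= l)%E.
    by rewrite -[1%E]/(1%:E) -[1]divr1 -{1}h1 lub// in_itv/= ltr01 lexx.
  have lfin : l \is a fin_num by rewrite ge0_fin_numE// (le_trans _ l1).
  exists (fine l); first by rewrite -lte_fin fineK// (lt_le_trans _ l1).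
  move=> t; rewrite in_itv/= le_eqVlt => /andP[/predU1P[<-|t0] t1].
    by rewrite h0 mulr0.
  by rewrite -ler_pdivrMr// -lee_fin fineK// lub// in_itv/= t0.
have slope_dominated : finite_slope -> expectation_dominated rho.
  move=> /linear_bound[c c0 hc']; exists c => // X XL X0.
  rewrite hrhoE//; apply: le_trans (distortion_integral_le hh X (ltW c0) hc') _.
  rewrite expectation_cdf_ccdf; last exact: XL.
  (* As [X >= 0] almost surely, its distribution function vanishes at every [x < 0], so the tail
     integral is the whole expectation. *)
  rewrite [X in (_ - X)%E]integral0_eq ?sube0// => x /=; rewrite in_itv/= => x0.
  suff /negligibleP : P.-negligible (X @^-1` `]-oo, x]).
    by apply; exact: measurable_funPTI.
  apply: negligibleS X0 => w /=; rewrite in_itv/= => Xx X0.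
  by move: Xx; rewrite leNgt (lt_le_trans x0).
have slope_finite : finite_slope -> finite_on_L1 rho.
  move=> /linear_bound[c c0 hc'] X XL.
  rewrite hrhoE//.
  apply: le_lt_trans (distortion_integral_le hh X (ltW c0) hc') _.
  apply: lte_mul_pinfty; rewrite ?lee_fin ?ltW//.
  have := expectation_fin_num XL.
  rewrite expectation_cdf_ccdf; last exact: XL.
  by rewrite fin_numB => /andP[+ _]; rewrite fin_numElt => /andP[].
(* Finiteness on nonnegative integrable variables follows both from domination and from finiteness
   on all of [L^1], so one counterexample serves both. *)
have slope_of : (forall X : {RV P >-> R}, (X : T -> R) \in Lfun P 1 ->
    (forall w, 0 <= X w) -> (rho X < +oo)%E) -> finite_slope.
  move=> rho_lty; exists l => //; rewrite ltNge leye_eq; apply/negP => /eqP loo.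
  have [|X [XL X0 Xoo]] := exists_distortion_integral_pinfty hP hh hc.
    move=> M; have : (M%:E < l)%E by rewrite loo ltry.
    move=> /ereal_sup_gt[_ [s s01 <-]].
    by rewrite lte_fin => /ltW; exists s.
  by have := rho_lty X XL X0; rewrite hrhoE// Xoo ltxx.
have dominated_slope : expectation_dominated rho -> finite_slope.
  move=> [c c0 hX]; apply: slope_of => X XL X0.
  apply: (le_lt_trans (hX X XL _)); first exact: aeW.
  by apply: lte_mul_pinfty; rewrite ?lee_fin ?ltW// ltey_eq expectation_fin_num.
have finite_slope_of : finite_on_L1 rho -> finite_slope.
  by move=> hX; apply: slope_of => X /hX.
split; last by split.
by split => [/dominated_slope/slope_finite|/finite_slope_of/slope_dominated].
Qed.
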